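(* There is an absolute constant $C>0$ such that the following holds. Consider the problem $\min_{x\in\mathbb{R}^d} F(x)$ with $F(x)=f(x)+\Psi(x)=\frac1n\sum_{i=1}^n f_i(x)+\Psi(x)$, where each $f_i$ is convex and $L$-smooth ($L>0$), and let $x^*$ be a minimizer of $F$. Let $x^\phi\in\mathbb{R}^d$, let $m_0$ and $S$ be positive integers, and let $\eta=1/(7L)$. Then the output $\widetilde{x}^S$ of $\mathtt{SVRG}^{++}(x^\phi,m_0,S,\eta)$ satisfies $$\mathbb{E}\big[F(\widetilde{x}^S)-F(x^* )\big]\le C\Big(\frac{F(x^\phi)-F(x^* )}{2^S}+\frac{L\|x^\phi-x^*\|^2}{2^S m_0}\Big).$$ In addition, $\mathtt{SVRG}^{++}(x^\phi,m_0,S,\eta)$ has gradient complexity at most $C\,(S\cdot n+2^S\cdot m_0)$.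
   Context: Setting: $n,d\ge 1$; each $f_i:\mathbb{R}^d\to\mathbb{R}$ is differentiable; $\Psi:\mathbb{R}^d\to\mathbb{R}\cup\{+\infty\}$ is proper, convex and lower semicontinuous; $F$ has a minimizer $x^*$. $\|\cdot\|$ is the Euclidean norm. A differentiable function $g$ is $L$-smooth if $\|\nabla g(x)-\nabla g(y)\|\le L\|x-y\|$ for all $x,y\in\mathbb{R}^d$. Algorithm $\mathtt{SVRG}^{++}(x^\phi,m_0,S,\eta)$: Set $\widetilde{x}^0=x^\phi$ and $x_0^1=x^\phi$. For epochs $s=1,\dots,S$: compute the full gradient $\widetilde\mu_{s-1}=\nabla f(\widetilde{x}^{s-1})$; set $m_s=2^s m_0$; for $t=0,\dots,m_s-1$ pick $i=i_t^s$ uniformly at random in $\{1,\dots,n\}$ (independently of all previous choices), set $\xi_t^s=\nabla f_i(x_t^s)-\nabla f_i(\widetilde{x}^{s-1})+\widetilde\mu_{s-1}$ and $$x_{t+1}^s=\arg\min_{y\in\mathbb{R}^d}\Big\{\frac1{2\eta}\|x_t^s-y\|^2+\Psi(y)+\langle\xi_t^s,y\rangle\Big\};$$ after the inner loop set $\widetilde{x}^s=\frac1{m_s}\sum_{t=1}^{m_s}x_t^s$ and $x_0^{s+1}=x_{m_s}^s$. Return $\widetilde{x}^S$. The gradient complexity is the total number of evaluations of component gradients $\nabla f_i(\cdot)$ (at a given index $i$ and point); a full gradient $\nabla f$ counts as $n$ evaluations. The expectation is over all random indices. *)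

(* Defs.v *)
From HB Require Import structures.
From mathcomp Require Import all_boot all_order all_algebra finmap.
From mathcomp Require Import all_classical all_reals all_analysis.

Set Implicit Arguments.
Unset Strict Implicit.
Unset Printing Implicit Defensive.

Import Order.TTheory GRing.Theory Num.Theory.
Import numFieldNormedType.Exports.

Local Open Scope classical_set_scope.
Local Open Scope ring_scope.

(* The library norm on 'rV[R]_d is the sup norm, so the Euclidean structure is
   introduced separately; both norms induce the same topology and hence the
   same notions of differentiability and lower semicontinuity. *)
Definition dot (R : realType) (d : nat) (u v : 'rV[R]_d) : R :=
  \sum_(j < d) u 0 j * v 0 j.

Definition enorm (R : realType) (d : nat) (u : 'rV[R]_d) : R :=
  Num.sqrt (dot u u).

Definition grad (R : realType) (d : nat) (g : 'rV[R]_d -> R) (x : 'rV[R]_d) :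
    'rV[R]_d :=
  \row_j 'D_(delta_mx 0 j) g x.

Definition smooth (R : realType) (d : nat) (L : R) (g : 'rV[R]_d -> R) : Prop :=
  (forall x, differentiable g x) /\
  (forall x y, enorm (grad g x - grad g y) <= L * enorm (x - y)).

Definition proper_fun (R : realType) (d : nat) (Psi : 'rV[R]_d -> \bar R) :
    Prop :=
  (forall x, Psi x != -oo%E) /\ (exists x, Psi x != +oo%E).

(* Since 0 * +oo = 0 in \bar R, the cases t = 0 and t = 1 hold trivially. *)
Definition ereal_convex (R : realType) (d : nat) (Psi : 'rV[R]_d -> \bar R) :
    Prop :=
  forall (x y : 'rV[R]_d) (t : R), 0 <= t <= 1 ->
    (Psi (t *: x + (1 - t) *: y)%R <= t%:E * Psi x + (1 - t)%:E * Psi y)%E.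

Definition average (R : realType) (n d : nat) (f : 'I_n -> 'rV[R]_d -> R)
    (x : 'rV[R]_d) : R :=
  n%:R^-1 * \sum_(i < n) f i x.

Definition composite (R : realType) (n d : nat) (f : 'I_n -> 'rV[R]_d -> R)
    (Psi : 'rV[R]_d -> \bar R) (x : 'rV[R]_d) : \bar R :=
  ((average f x)%:E + Psi x)%E.

Definition minimizers (R : realType) (d : nat) (g : 'rV[R]_d -> \bar R) :
    set 'rV[R]_d :=
  [set y | forall z, (g y <= g z)%E].

(* The default 0 is returned only if g has no minimizer. *)
Definition argmin (R : realType) (d : nat) (g : 'rV[R]_d -> \bar R) :
    'rV[R]_d :=
  xget 0 (minimizers g).

Definition prox_step (R : realType) (d : nat) (Psi : 'rV[R]_d -> \bar R)
    (eta : R) (x xi : 'rV[R]_d) : 'rV[R]_d :=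
  argmin (fun y : 'rV[R]_d =>
    (((2 * eta)^-1 * enorm (x - y) ^+ 2)%:E + Psi y + (dot xi y)%:E)%E).

(* Programs whose only access to the functions f_i is an oracle returning the
   component gradient of index i at a chosen point: the gradient complexity of
   a run is the number of oracle queries made in it. *)
Inductive oracle_prog (R : realType) (n d : nat) (A : Type) : Type :=
| Ret of A
| Query of 'I_n & 'rV[R]_d & ('rV[R]_d -> oracle_prog R n d A).

Arguments Ret {R n d A}.
Arguments Query {R n d A}.

Fixpoint bind (R : realType) (n d : nat) (A B : Type)
    (p : oracle_prog R n d A) (k : A -> oracle_prog R n d B) :
    oracle_prog R n d B :=
  match p with
  | Ret a => k a
  | Query i x q => Query i x (fun g => bind (q g) k)
  end.

Fixpoint result (R : realType) (n d : nat) (A : Type)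
    (oracle : 'I_n -> 'rV[R]_d -> 'rV[R]_d) (p : oracle_prog R n d A) : A :=
  match p with
  | Ret a => a
  | Query i x q => result oracle (q (oracle i x))
  end.

Fixpoint queries (R : realType) (n d : nat) (A : Type)
    (oracle : 'I_n -> 'rV[R]_d -> 'rV[R]_d) (p : oracle_prog R n d A) : nat :=
  match p with
  | Ret a => 0%N
  | Query i x q => (queries oracle (q (oracle i x))).+1
  end.

Fixpoint sum_grads (R : realType) (n d : nat) (s : seq 'I_n) (x : 'rV[R]_d) :
    oracle_prog R n d 'rV[R]_d :=
  match s with
  | [::] => Ret 0
  | i :: s' =>
      Query i x (fun g => bind (sum_grads s' x) (fun h => Ret (g + h)))
  end.

Definition full_grad (R : realType) (n d : nat) (x : 'rV[R]_d) :
    oracle_prog R n d 'rV[R]_d :=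
  bind (sum_grads (enum 'I_n) x) (fun g => Ret (n%:R^-1 *: g)).

Definition inner_step (R : realType) (n d : nat) (Psi : 'rV[R]_d -> \bar R)
    (eta : R) (xt mu x : 'rV[R]_d) (i : 'I_n) : oracle_prog R n d 'rV[R]_d :=
  Query i x (fun g => Query i xt (fun h =>
    Ret (prox_step Psi eta x (g - h + mu)))).

(* Returns x_t together with x_1 + ... + x_t. *)
Fixpoint inner_loop (R : realType) (n d : nat) (Psi : 'rV[R]_d -> \bar R)
    (eta : R) (idx : nat -> 'I_n) (xt mu x0 : 'rV[R]_d) (t : nat) :
    oracle_prog R n d ('rV[R]_d * 'rV[R]_d) :=
  match t with
  | 0 => Ret (x0, 0)
  | t'.+1 =>
      bind (inner_loop Psi eta idx xt mu x0 t') (fun '(x, sx) =>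
      bind (inner_step Psi eta xt mu x (idx t')) (fun x' =>
      Ret (x', sx + x')))
  end.

Definition epoch (R : realType) (n d : nat) (Psi : 'rV[R]_d -> \bar R)
    (eta : R) (idx : nat -> 'I_n) (m : nat) (xt x0 : 'rV[R]_d) :
    oracle_prog R n d ('rV[R]_d * 'rV[R]_d) :=
  bind (full_grad n xt) (fun mu =>
  bind (inner_loop Psi eta idx xt mu x0 m) (fun '(x, sx) =>
  Ret (m%:R^-1 *: sx, x))).

(* Returns the snapshot of epoch S and the starting point of epoch S + 1;
   [idx s t] is the index picked at inner iteration t of epoch s. *)
Fixpoint epochs (R : realType) (n d : nat) (Psi : 'rV[R]_d -> \bar R)
    (xphi : 'rV[R]_d) (m0 : nat) (eta : R) (idx : nat -> nat -> 'I_n)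
    (S : nat) : oracle_prog R n d ('rV[R]_d * 'rV[R]_d) :=
  match S with
  | 0 => Ret (xphi, xphi)
  | s.+1 =>
      bind (epochs Psi xphi m0 eta idx s) (fun '(xt, x0) =>
      epoch Psi eta (idx s.+1) (2 ^ s.+1 * m0) xt x0)
  end.

Definition svrgpp (R : realType) (n d : nat) (Psi : 'rV[R]_d -> \bar R)
    (xphi : 'rV[R]_d) (m0 S : nat) (eta : R) (idx : nat -> nat -> 'I_n) :
    oracle_prog R n d 'rV[R]_d :=
  bind (epochs Psi xphi m0 eta idx S) (fun '(xt, _) => Ret xt).

(* The pairs (s, t) at which an index is drawn. *)
Definition svrgpp_draws (m0 S : nat) : set (nat * nat) :=
  [set k | (1 <= k.1 <= S)%N && (k.2 < 2 ^ k.1 * m0)%N].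

(* The X k, for k in D, are random variables that are uniform on 'I_n and
   mutually independent. *)
Definition iid_uniform (R : realType) (disp : measure_display)
    (T : measurableType disp) (P : probability T R) (K : choiceType)
    (D : set K) (n : nat) (X : K -> T -> 'I_n) : Prop :=
  [/\ forall k (A : set 'I_n), D k -> measurable (X k @^-1` A),
      forall k (i : 'I_n), D k -> P (X k @^-1` [set i]) = (n%:R^-1)%:E
    & forall (J : {fset K}) (A : K -> set 'I_n), [set` J] `<=` D ->
        P (\bigcap_(k in [set` J]) (X k @^-1` A k)) =
        (\prod_(k <- J) P (X k @^-1` A k))%E].

(* Main.v *)
(* Write gap = F - F(x* ), let xt be the snapshot of the current epoch, and take
   eta = 1 / (7 L). The descent lemma, the first-order optimality of the proximal
   step and the variance bound
     E |xi - grad f(x)|^2 <= 4 L (gap x + gap xt)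
   (a consequence of co-coercivity of the gradients) give, for the next iterate x',
     E [gap x' + 7L/2 |x' - x*|^2] <= gap x / 3 + gap xt / 3 + 7L/2 |x - x*|^2.
   Summing over an epoch and using that epoch lengths double,
     2^s gap xt_s + gap x_s / (2 m0) + 21 L / (4 m0) |x_s - x*|^2
   is a supermartingale across epochs, x_s being the last iterate of epoch s;
   dividing by 2^S yields the bound.
   The proximal minimizer exists because the minimality of x* gives Psi a
   quadratic minorant of curvature L, below the curvature 7 L of the proximal term. *)
Require Import Defs.
From mathcomp Require Import all_boot all_order all_algebra finmap.
From mathcomp Require Import all_classical all_reals all_analysis.
From mathcomp Require Import measurable_realfun.
From mathcomp Require Import zify ring lra.

Set Implicit Arguments.
Unset Strict Implicit.
Unset Printing Implicit Defensive.

Import Order.TTheory GRing.Theory Num.Theory.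
Import numFieldNormedType.Exports.

Local Open Scope classical_set_scope.
Local Open Scope ring_scope.

(** * Gradients of smooth convex functions *)

Section EuclideanStructure.
Variables (R : realType) (d : nat).
Implicit Types (u v w : 'rV[R]_d) (a : R).

Lemma dotC u v : dot u v = dot v u.
Proof. by apply: eq_bigr => j _; rewrite mulrC. Qed.

Lemma dotDl u v w : dot (u + v) w = dot u w + dot v w.
Proof. by rewrite -big_split; apply: eq_bigr => j _; rewrite mxE mulrDl. Qed.

Lemma dotZl a u v : dot (a *: u) v = a * dot u v.
Proof. by rewrite mulr_sumr; apply: eq_bigr => j _; rewrite mxE mulrA. Qed.

Lemma dotNl u v : dot (- u) v = - dot u v.
Proof. by rewrite -scaleN1r dotZl mulN1r. Qed.

Lemma dotDr u v w : dot w (u + v) = dot w u + dot w v.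
Proof. by rewrite dotC dotDl !(dotC _ w). Qed.

Lemma dotZr a u v : dot v (a *: u) = a * dot v u.
Proof. by rewrite dotC dotZl dotC. Qed.

Lemma dotNr u v : dot v (- u) = - dot v u.
Proof. by rewrite dotC dotNl dotC. Qed.

Lemma dot0l u : dot 0 u = 0.
Proof. by rewrite -(scale0r 0) dotZl mul0r. Qed.

Definition dotE := (dotDl, dotDr, dotNl, dotNr, dotZl, dotZr).

Lemma dot_suml (I : Type) (r : seq I) (F : I -> 'rV[R]_d) v :
  dot (\sum_(i <- r) F i) v = \sum_(i <- r) dot (F i) v.
Proof.
by elim/big_rec2: _ => [|i x y _ <-]; rewrite ?dot0l // dotDl.
Qed.

Lemma dot_ge0 u : 0 <= dot u u.
Proof. by apply: sumr_ge0 => j _; rewrite -expr2 sqr_ge0. Qed.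

Lemma sqr_enorm u : enorm u ^+ 2 = dot u u.
Proof. by rewrite sqr_sqrtr ?dot_ge0. Qed.

Lemma dotBZ a u v :
  dot (u - a *: v) (u - a *: v) = dot u u - 2 * a * dot u v + a ^+ 2 * dot v v.
Proof. by rewrite !dotE (dotC v u); ring. Qed.

Lemma dotBB u v : dot (u - v) (u - v) = dot u u - 2 * dot u v + dot v v.
Proof. by rewrite -[v]scale1r dotBZ scale1r; ring. Qed.

Lemma dotB_le u v : dot (u - v) (u - v) <= 2 * dot u u + 2 * dot v v.
Proof.
have := dot_ge0 (u + v).
rewrite !dotE (dotC v u); lra.
Qed.

Lemma sqr_coord_le u j : u 0 j ^+ 2 <= dot u u.
Proof.
rewrite /dot (bigD1 j) //= -expr2 lerDl.
by apply: sumr_ge0 => i _; rewrite -expr2 sqr_ge0.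
Qed.

Lemma dot_continuous u : continuous (dot u).
Proof.
apply: continuous_big => [|j _ x]; first exact: add_continuous.
by apply: continuousM; [exact: cst_continuous|exact: coord_continuous].
Qed.

Lemma dot_self_continuous : continuous (fun u => dot u u).
Proof.
apply: continuous_big => [|j _ x]; first exact: add_continuous.
by apply: continuousM; exact: coord_continuous.
Qed.

End EuclideanStructure.

(** * Descent lemma and co-coercivity of gradients *)

Section SmoothConvex.
Variables (R : realType) (d : nat).
Implicit Types (g : 'rV[R]_d -> R) (x y v : 'rV[R]_d).

Lemma derive_grad g x v : differentiable g x -> 'D_v g x = dot (grad g x) v.
Proof.
move=> dg; rewrite deriveE // {1}(row_sum_delta v) linear_sum.
apply: eq_bigr => j _; rewrite linearZ /= mxE deriveE //.
by rewrite mulrC.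
Qed.

Lemma is_derive_line g x v (t : R) : differentiable g (x + t *: v) ->
  is_derive t 1 (fun s : R => g (x + s *: v)) (dot (grad g (x + t *: v)) v).
Proof.
move=> dg.
have quotE : (fun h : R => h^-1 *:
      (((fun s : R => g (x + s *: v)) \o shift t) (h *: 1) - g (x + t *: v))) =
    (fun h : R => h^-1 *: ((g \o shift (x + t *: v)) (h *: v) - g (x + t *: v))).
  apply/funext => h /=; congr (_ *: (g _ - _)).
  by rewrite /shift /= [h *: 1]mulr1 scalerDl addrCA.
apply: DeriveDef.
  by rewrite /derivable quotE; exact: diff_derivable.
by rewrite -derive_grad // /derive quotE.
Qed.

Lemma convex_function_le g x y (t : R) : convex_function setT g ->
  0 <= t <= 1 -> g (t *: x + (1 - t) *: y) <= t * g x + (1 - t) * g y.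
Proof.
move=> cg /andP[t0 t1].
exact: (cg (Itv01 t0 t1) x y (in_setT _) (in_setT _)).
Qed.

(** Convexity bounds the difference quotient in direction [y - x] by [g y - g x] for steps [h] in
    (0, 1]; the bound passes to the limit from the right. *)
Lemma convex_grad_le g x y : convex_function setT g -> differentiable g x ->
  g x + dot (grad g x) (y - x) <= g y.
Proof.
move=> cg dg.
rewrite -derive_grad // addrC -lerBrDr.
have /cvg_dnbhs_at_right lim_right : derivable g x (y - x) by exact: diff_derivable.
apply: (cvgr_to_le lim_right); near=> h.
have h0 : 0 < h by near: h; exact: nbhs_right_gt.
have h1 : h <= 1 by near: h; exact: nbhs_right_ltW.
have h01 : 0 <= h <= 1 by rewrite ltW.
have -> : (g \o shift x) (h *: (y - x)) = g (h *: y + (1 - h) *: x).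
  by rewrite /= scalerBr scalerBl scale1r; congr g; rewrite -!addrA [_ + x]addrC.
have := convex_function_le y x cg h01.
rewrite [h^-1 *: _]mulrC ler_pdivrMr //; nra.
Unshelve. all: by end_near. Qed.

(** Mean value theorem on [0, 1] for [phi], which is [g] along the segment minus the linear and
    quadratic terms of the bound; the Lipschitz gradient makes [dphi] nonpositive. *)
Lemma smooth_le (L : R) g x y : 0 < L -> smooth L g ->
  g y <= g x + dot (grad g x) (y - x) + L / 2 * dot (y - x) (y - x).
Proof.
move=> L0 [dg Lg]; set v := y - x; set q := dot v v.
pose c := dot (grad g x) v.
pose phi (t : R) := g (x + t *: v) - t * c - L / 2 * q * t ^+ 2.
pose dphi (t : R) := dot (grad g (x + t *: v)) v - c - L * q * t.
have phi' (t : R) : is_derive t 1 phi (dphi t).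
  have gl := is_derive_line (dg (x + t *: v)).
  have -> : phi = (fun s : R => g (x + s *: v)) - c \*: (id : R -> R)
      - (L / 2 * q) \*: ((id : R -> R) ^+ 2).
    by apply/funext => s; rewrite /phi !fctE /= [s * c]mulrC.
  apply: is_derive_eq.
  by rewrite /GRing.scale /= /dphi; field.
have cphi : {within `[0, 1], continuous phi}.
  by apply: derivable_within_continuous => t _; exact: (@ex_derive _ _ _ _ _ _ _ (phi' t)).
have [t] := MVT_segment ler01 (fun t _ => phi' t) cphi.
rewrite in_itv /= => /andP[t0 t1].
rewrite subr0 mulr1 /phi scale1r scale0r addr0 /v [x + _]addrC subrK -/v.
have : dphi t <= 0; last by rewrite /c; lra.
(* At [t = 0] the derivative vanishes; elsewhere its sign is checked after multiplying by
   [L * t > 0]. *)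
move: t0; rewrite le_eqVlt => /predU1P[<-|t0].
  by rewrite /dphi scale0r addr0 /c mulr0; lra.
(* AM-GM: 2 (L t) <u, v> <= |u|^2 + (L t)^2 |v|^2 *)
pose u := grad g (x + t *: v) - grad g x.
have uL : dot u u <= (L * t) ^+ 2 * q.
  have := Lg (x + t *: v) x; rewrite -/u [x + _]addrC addrK => le_u.
  rewrite -[dot u u]sqr_enorm.
  have -> : (L * t) ^+ 2 * q = (L * enorm (t *: v)) ^+ 2.
    by rewrite !exprMn sqr_enorm dotZl dotZr -/q; ring.
  rewrite ler_sqr ?nnegrE ?mulr_ge0 ?sqrtr_ge0 //; exact: ltW.
have dphiE : dphi t = dot u v - L * t * q.
  by rewrite /dphi /u dotDl dotNl -/c; ring.
have Lt0 : 0 < L * t by rewrite mulr_gt0.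
rewrite dphiE -(pmulr_rle0 _ Lt0).
have := dot_ge0 (u - (L * t) *: v).
rewrite dotBZ -/q; nra.
Qed.

(** At the gradient step [x - L^-1 *: w], the tangent plane of [g] at [y] lies below the quadratic
    upper model at [x]; comparing the two leaves |w|^2 / (2 L). *)
Lemma cocoercive (L : R) g x y : 0 < L -> convex_function setT g ->
  smooth L g ->
  dot (grad g x - grad g y) (grad g x - grad g y) <=
    2 * L * (g x - g y - dot (grad g y) (x - y)).
Proof.
move=> L0 cg sg; set w := grad g x - grad g y.
have := smooth_le x (x - L^-1 *: w) L0 sg.
have := convex_grad_le (x - L^-1 *: w) cg (sg.1 y).
rewrite [x - _ - x]addrAC subrr add0r.
have -> : x - L^-1 *: w - y = (x - y) - L^-1 *: w by rewrite addrAC.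
rewrite dotDr !dotNr !dotZr dotNl dotZl.
have wE : dot (grad g x) w - dot (grad g y) w = dot w w.
  by rewrite -dotNl -dotDl.
move: wE; set a := dot (grad g x) w; set b := dot (grad g y) w.
set W := dot w w; set G := dot _ (x - y) => wE Hc Hs.
have LwE : L^-1 * a - L^-1 * b = L^-1 * W by rewrite -mulrBr wE.
have quadE : L / 2 * - (L^-1 * - (L^-1 * W)) = L^-1 * W / 2.
  by field; rewrite gt_eqF.
have H : L^-1 * W / 2 <= g x - g y - G by rewrite quadE in Hs; lra.
have L20 : 0 <= 2 * L by lra.
have := ler_wpM2l L20 H.
by have -> : 2 * L * (L^-1 * W / 2) = W by field; rewrite gt_eqF.
Qed.

End SmoothConvex.

(** * The proximal step *)

(** Without a minimizer, the open sets [a < G], over levels [a] at or above some value of [G], cover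
    the compact sublevel set. The least level of a finite subcover would lie strictly below [G] on
    all of that set, yet some point of it has [G] at most that level. *)
Lemma lsc_minimizer (R : realType) (T : ptopologicalType) (G : T -> \bar R)
    (K : set T) (r : R) (z0 : T) :
  lower_semicontinuous G -> (forall y, G y != -oo%E) -> compact K ->
  [set y | (G y <= r%:E)%E] `<=` K -> (G z0 <= r%:E)%E ->
  exists p, forall z, (G p <= G z)%E.
Proof.
move=> lscG Gproper cK subK Gz0; apply: contrapT => nomin.
pose A := [set y | (G y <= r%:E)%E].
have openU (a : R) : open [set y | (a%:E < G y)%E].
  exact: (lower_semicontinuousP G).1.
have cA : compact A.
  apply: (subclosed_compact _ cK subK).
  rewrite -openC (_ : ~` A = [set y | (r%:E < G y)%E]) //.
  by apply/seteqP; split => y /=; rewrite ltNge => /negP.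
pose D := [set a : R | exists z, (G z <= a%:E)%E].
have coverA : A `<=` cover D (fun a => [set y | (a%:E < G y)%E]).
  move=> y Ay.
  have [z Gzy] : exists z, (G z < G y)%E.
    apply: contrapT => nz; apply: nomin; exists y => z.
    by rewrite leNgt; apply/negP => lt_zy; apply: nz; exists z.
  have Gz_fin : G z \is a fin_num.
    rewrite fin_numE Gproper /=; apply/eqP => Gz.
    by move: (lt_le_trans Gzy Ay); rewrite Gz.
  exists (fine (G z)); rewrite /= ?fineK //.
  by exists z; rewrite fineK.
move: cA; rewrite compact_cover => /(_ _ _ _ (fun a _ => openU a) coverA).
case=> D' D'D coverD'.
have [a0 a0D' _] := coverD' z0 Gz0.
case: (@Order.TotalTheory.arg_minP _ _ D' [` a0D']%fset xpredT val isT) => /= a _ a_min.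
have [z Gza] : D (val a) by apply/set_mem/D'D/fsvalP.
have lt_a y : A y -> ((val a)%:E < G y)%E.
  move=> /coverD'[b bD' /=]; apply: le_lt_trans.
  by rewrite lee_fin; exact: (a_min [` bD']%fset).
have lt_az0 := lt_a z0 Gz0.
have /lt_a : A z by exact: le_trans Gza (ltW (lt_le_trans lt_az0 Gz0)).
by rewrite ltNge Gza.
Qed.

Lemma lsc_add_continuous (R : realType) (T : topologicalType) (h : T -> R)
    (Psi : T -> \bar R) :
  continuous h -> lower_semicontinuous Psi ->
  lower_semicontinuous (fun y => ((h y)%:E + Psi y)%E).
Proof.
move=> ch lscPsi x a lt_a.
(* [b] splits the strict inequality: [Psi > b] and [h > a - b] both hold near [x]. Where [Psi x] is
   infinite, any [b] above [a - h x] works. *)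
have [b [lt_b lt_ab]] : exists b : R, (b%:E < Psi x)%E /\ a - h x < b.
  case: (Psi x) lt_a => [s| |] //=.
  - rewrite -EFinD lte_fin => lt_a; exists ((a - h x + s) / 2).
    by rewrite lte_fin; split; lra.
  - by move=> _; exists (a - h x + 1); rewrite ltry; split => //; lra.
have [V Vx lt_V] := lscPsi x b lt_b.
have nearh : \forall y \near x, a - b < h y.
  by apply: (cvgr_gt _ (ch x)); lra.
exists (V `&` [set y | a - b < h y]); first exact: filterI.
move=> y [Vy /= lt_h].
apply: (@lt_le_trans _ _ ((h y)%:E + b%:E)%E).
  by rewrite -EFinD lte_fin; lra.
by rewrite leeD2l // ltW // lt_V.
Qed.

Lemma slope_ge0 (R : realType) (A B : R) :
  (forall t, 0 < t <= 1 -> 0 <= t * A + t ^+ 2 * B) -> 0 <= A.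
Proof.
move=> H; rewrite leNgt; apply/negP => A0.
have B0 := normr_ge0 B; have leB := ler_norm B.
have den0 : 0 < - A + `|B| by lra.
(* For this [t], [t * |B| = - A + t * A], hence [A + t * B <= t * A < 0]. *)
pose t := - A / (- A + `|B|).
have t0 : 0 < t by rewrite divr_gt0 //; lra.
have t1 : t <= 1 by rewrite ler_pdivrMr //; lra.
have tE : t * (- A + `|B|) = - A by rewrite divfK // gt_eqF.
have : 0 <= t * (A + t * B).
  by have := H t; rewrite t0 t1 => /(_ isT); rewrite expr2 mulrDr mulrA.
rewrite pmulr_rge0 //; nra.
Qed.

Section Prox.
Variables (R : realType) (d : nat) (Psi : 'rV[R]_d -> \bar R).
Hypotheses (Psi_proper : proper_fun Psi) (Psi_convex : ereal_convex Psi).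
Implicit Types (x y z u p w xi : 'rV[R]_d).

(** Move from [p] towards [u] by a fraction [t], bound [Psi] by convexity and compare terms of first
    order in [t]. The quadratic upper bound lets [w] act as the gradient of [h], so the lemma serves
    both the smooth average and the proximal quadratic. *)
Lemma minimizer_first_order (h : 'rV[R]_d -> R) p u w (B a b : R) :
  (forall z, h z <= h p + dot w (z - p) + B * dot (z - p) (z - p)) ->
  (forall z, ((h p)%:E + Psi p <= (h z)%:E + Psi z)%E) ->
  Psi p = a%:E -> Psi u = b%:E -> a <= b + dot w (u - p).
Proof.
move=> h_le p_min Pp Pu.
suff : 0 <= b - a + dot w (u - p) by lra.
apply: (@slope_ge0 _ _ (B * dot (u - p) (u - p))) => t /andP[t0 t1].
have t01 : 0 <= t <= 1 by rewrite ltW.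
pose z := t *: u + (1 - t) *: p.
have zE : z - p = t *: (u - p).
  by apply/rowP => j; rewrite !mxE; ring.
have Pz := Psi_convex u p t01; rewrite -/z Pp Pu -!EFinM -EFinD in Pz.
have := le_trans (p_min z) (leeD2l _ Pz).
rewrite Pp -!EFinD lee_fin.
have := h_le z; rewrite zE !(dotZl, dotZr); nra.
Qed.

(** Young's inequality, from |w + k u|^2 >= 0. It gives coercivity of the proximal objective and
    later absorbs the gradient noise. *)
Lemma quad_growth w u (k : R) : 0 < k ->
  - dot w u <= dot w w / (2 * k) + k / 2 * dot u u.
Proof.
move=> k0; have := dot_ge0 (w - (- k) *: u); rewrite dotBZ sqrrN => H.
have -> : dot w w / (2 * k) + k / 2 * dot u u =
    (dot w w - 2 * - k * dot w u + k ^+ 2 * dot u u) / (2 * k) - dot w u.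
  by field; rewrite gt_eqF.
by rewrite lerDr divr_ge0 //; lra.
Qed.

(** Convertible to the function minimized in [prox_step]. *)
Definition prox_obj (eta : R) x xi y : \bar R :=
  (((2 * eta)^-1 * enorm (x - y) ^+ 2)%:E + Psi y + (dot xi y)%:E)%E.

Lemma prox_objE eta x xi y : prox_obj eta x xi y =
  (((2 * eta)^-1 * dot (y - x) (y - x) + dot xi y)%:E + Psi y)%E.
Proof.
by rewrite /prox_obj sqr_enorm addeAC -EFinD -(opprB y x) dotNl dotNr opprK.
Qed.

Hypothesis Psi_lsc : lower_semicontinuous Psi.

(* A quadratic minorant of Psi with curvature below 1 / eta makes the proximal
   objective coercive. *)
Lemma prox_step_min (eta B c : R) w x xi :
  0 < eta -> B < (2 * eta)^-1 ->
  (forall z, ((c + dot w (z - x) - B * dot (z - x) (z - x))%:E <= Psi z)%E) ->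
  forall z, (prox_obj eta x xi (prox_step Psi eta x xi) <= prox_obj eta x xi z)%E.
Proof.
move=> eta0 ltB Psi_ge.
suff [p minp] : exists p, minimizers (prox_obj eta x xi) p.
  exact: (@xgetPex _ 0 (minimizers (prox_obj eta x xi)) (ex_intro _ p minp)).
have [Psi_ninfty [z0 Pz0]] := Psi_proper.
pose h y := (2 * eta)^-1 * dot (y - x) (y - x) + dot xi y.
have objE : prox_obj eta x xi = fun y => ((h y)%:E + Psi y)%E.
  by apply/funext => y; rewrite prox_objE.
have Pz0_fin : Psi z0 \is a fin_num by rewrite fin_numE Psi_ninfty.
pose r := h z0 + fine (Psi z0).
have ch : continuous h.
  move=> y; apply: (@continuousD _ _ _ (fun y => (2 * eta)^-1 * dot (y - x) (y - x)) (dot xi)).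
    apply: continuousM; first exact: cst_continuous.
    apply: (@continuous_comp _ _ _ (fun y => y - x) (fun v : 'rV[R]_d => dot v v)).
      by apply: continuousB => //; exact: cst_continuous.
    exact: dot_self_continuous.
  exact: dot_continuous.
pose k := (2 * eta)^-1 - B.
have k0 : 0 < k by rewrite subr_gt0.
pose s := w + xi.
(* On the sublevel set, k |y - x|^2 + <s, y - x> <= r - c - <xi, x>; Young's inequality at [s]
   spends half of [k], which leaves |y - x|^2 <= M. *)
pose M := (r - c - dot xi x + dot s s / (2 * k)) * 2 / k.
(* A coordinate whose square is at most M is itself at most M + 1 in absolute value, which avoids a
   square root. *)
pose K := [set v : 'rV[R]_d | forall j, `[x 0 j - (M + 1), x 0 j + (M + 1)]%classic (v 0 j)].
rewrite objE.
apply: (@lsc_minimizer _ _ _ K r z0).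
- exact: lsc_add_continuous.
- by move=> y; rewrite adde_eq_ninfty negb_or /= Psi_ninfty.
- exact: (@rV_compact R d _ (fun j => @segment_compact R _ _)).
- move=> y /= le_r j.
  have le_dot : dot (y - x) (y - x) <= M.
    have := le_trans (leeD2l (h y)%:E (Psi_ge y)) le_r.
    rewrite -EFinD lee_fin /h => le_r'.
    have xiE : dot xi y = dot xi (y - x) + dot xi x.
      by rewrite -dotDr subrK.
    have := quad_growth s (y - x) k0; rewrite {1}/s dotDl => le_s.
    rewrite /M -mulrA mulrC -ler_pdivrMl ?divr_gt0 // invf_div.
    rewrite xiE in le_r'; rewrite /k in le_s *; lra.
  have := le_trans (sqr_coord_le (y - x) j) le_dot.
  rewrite !mxE => le_M.
  have := sqr_ge0 (y 0 j - x 0 j - 1); have := sqr_ge0 (y 0 j - x 0 j + 1).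
  rewrite /= in_itv /=; move: (y 0 j) (x 0 j) M le_M {le_dot K} => a b M le_M.
  by move=> ? ?; apply/andP; split; nra.
- by rewrite /r (EFinD (h z0)) fineK.
Qed.

(** Three-point inequality: first-order optimality of [p] tested against [u], with <p - x, u - p> /
    eta expanded by polarization. *)
Lemma prox_step_le (eta B c b : R) w x xi u :
  0 < eta -> B < (2 * eta)^-1 ->
  (forall z, ((c + dot w (z - x) - B * dot (z - x) (z - x))%:E <= Psi z)%E) ->
  Psi u = b%:E ->
  let p := prox_step Psi eta x xi in
  exists2 a, Psi p = a%:E &
    a <= b + dot xi (u - p) +
      (2 * eta)^-1 * (dot (x - u) (x - u) - dot (p - x) (p - x) - dot (p - u) (p - u)).
Proof.
move=> eta0 ltB Psi_ge Pu p.
have p_min := prox_step_min xi eta0 ltB Psi_ge; rewrite -/p in p_min.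
have Pp_fin : Psi p \is a fin_num.
  rewrite fin_numE Psi_proper.1 /=; apply/eqP => Pp.
  by have := p_min u; rewrite !prox_objE Pp Pu /= -EFinD leye_eq.
exists (fine (Psi p)); first by rewrite fineK.
pose h y := (2 * eta)^-1 * dot (y - x) (y - x) + dot xi y.
have := @minimizer_first_order h p u (xi + eta^-1 *: (p - x)) ((2 * eta)^-1)
  (fine (Psi p)) b.
rewrite fineK // => /(_ _ _ erefl Pu) first_order.
have -> : b + dot xi (u - p) + (2 * eta)^-1 *
    (dot (x - u) (x - u) - dot (p - x) (p - x) - dot (p - u) (p - u)) =
    b + dot (xi + eta^-1 *: (p - x)) (u - p).
  rewrite !dotE (dotC x u) (dotC p x) (dotC p u).
  by field; rewrite gt_eqF.
apply: first_order => z; last by rewrite -!prox_objE.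
rewrite le_eqVlt /h; apply/orP; left; apply/eqP.
rewrite !dotE (dotC x z) (dotC p x) (dotC p z).
by field; rewrite gt_eqF.
Qed.

End Prox.

(** * One SVRG iteration *)

Section Mean.
Variables (R : realType) (n : nat).
Hypothesis n_gt0 : (0 < n)%N.

Definition mean (X : 'I_n -> R) : R := n%:R^-1 * \sum_(i < n) X i.

Let n_neq0 : n%:R != 0 :> R. Proof. by rewrite pnatr_eq0 -lt0n. Qed.

Lemma mean_cst (c : R) : mean (fun=> c) = c.
Proof. by rewrite /mean sumr_const card_ord -[c *+ n]mulr_natl mulKf. Qed.

Lemma meanD (X Y : 'I_n -> R) : mean (fun i => X i + Y i) = mean X + mean Y.
Proof. by rewrite /mean big_split mulrDr. Qed.

Lemma meanZ (c : R) (X : 'I_n -> R) : mean (fun i => c * X i) = c * mean X.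
Proof. by rewrite /mean -mulr_sumr mulrCA. Qed.

Lemma meanB (X Y : 'I_n -> R) : mean (fun i => X i - Y i) = mean X - mean Y.
Proof. by rewrite /mean sumrB mulrBr. Qed.

Lemma mean_le (X Y : 'I_n -> R) : (forall i, X i <= Y i) -> mean X <= mean Y.
Proof. by move=> leXY; rewrite ler_wpM2l ?invr_ge0 // ler_sum. Qed.

Lemma eq_mean (X Y : 'I_n -> R) : X =1 Y -> mean X = mean Y.
Proof. by move=> eqXY; congr (_ * _); apply: eq_bigr => i _. Qed.

Variable d : nat.

Definition vmean (v : 'I_n -> 'rV[R]_d) : 'rV[R]_d := n%:R^-1 *: \sum_(i < n) v i.

Lemma vmean_cst (v : 'rV[R]_d) : vmean (fun=> v) = v.
Proof.
by rewrite /vmean sumr_const card_ord -(scaler_nat n v) scalerA mulVf // scale1r.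
Qed.

Lemma vmeanD (u v : 'I_n -> 'rV[R]_d) :
  vmean (fun i => u i + v i) = vmean u + vmean v.
Proof. by rewrite /vmean big_split scalerDr. Qed.

Lemma vmeanB (u v : 'I_n -> 'rV[R]_d) :
  vmean (fun i => u i - v i) = vmean u - vmean v.
Proof. by rewrite /vmean sumrB scalerBr. Qed.

Lemma dot_vmean (v : 'I_n -> 'rV[R]_d) u :
  dot (vmean v) u = mean (fun i => dot (v i) u).
Proof. by rewrite dotZl dot_suml. Qed.

(** The two sides differ by |vmean v|^2. *)
Lemma mean_sqr_center (v : 'I_n -> 'rV[R]_d) :
  mean (fun i => dot (v i - vmean v) (v i - vmean v)) <=
    mean (fun i => dot (v i) (v i)).
Proof.
rewrite (@eq_mean _ (fun i => dot (v i) (v i) - 2 * dot (v i) (vmean v)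
    + dot (vmean v) (vmean v))); last first.
  by move=> i; rewrite dotBB.
rewrite meanD meanB (meanZ 2) mean_cst -dot_vmean.
have := dot_ge0 (vmean v); lra.
Qed.

Lemma mean_sqrB_le (u v : 'I_n -> 'rV[R]_d) :
  mean (fun i => dot (u i - v i) (u i - v i)) <=
    2 * mean (fun i => dot (u i) (u i)) + 2 * mean (fun i => dot (v i) (v i)).
Proof. by rewrite -!meanZ -meanD; apply: mean_le => i; exact: dotB_le. Qed.

End Mean.

(** * Variance and descent estimates for the composite problem *)

Section CompositeProblem.
Variables (R : realType) (n d : nat) (f : 'I_n -> 'rV[R]_d -> R).
Variables (Psi : 'rV[R]_d -> \bar R) (L : R) (xs : 'rV[R]_d).
Hypotheses (n_gt0 : (0 < n)%N) (L_gt0 : 0 < L).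
Hypotheses (f_convex : forall i, convex_function setT (f i)).
Hypotheses (f_smooth : forall i, smooth L (f i)).
Hypotheses (Psi_proper : proper_fun Psi) (Psi_convex : ereal_convex Psi).
Hypotheses (Psi_lsc : lower_semicontinuous Psi).
Hypothesis xs_min : minimizers (composite f Psi) xs.
Implicit Types (x y z u p xi xt : 'rV[R]_d).

Definition gmean x := vmean (fun i => grad (f i) x).

(** [fine] sends infinite values to 0, so this is [F x - F xs] only where [Psi x] is finite; hence
    the finiteness conditions carried along below. *)
Definition gap x : R :=
  average f x + fine (Psi x) - (average f xs + fine (Psi xs)).

Lemma average_grad_le x y : average f x + dot (gmean x) (y - x) <= average f y.
Proof.
rewrite dot_vmean -[average f x]/(mean (f^~ x)) -meanD.
by apply: mean_le => i; exact: convex_grad_le (f_convex i) ((f_smooth i).1 x).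
Qed.

Lemma average_smooth_le x y :
  average f y <= average f x + dot (gmean x) (y - x) + L / 2 * dot (y - x) (y - x).
Proof.
rewrite -[X in _ + X](mean_cst n_gt0) dot_vmean -[average f x]/(mean (f^~ x)).
rewrite -!meanD; apply: mean_le => i; exact: smooth_le.
Qed.

Lemma average_convex x y (t : R) : 0 <= t <= 1 ->
  average f (t *: x + (1 - t) *: y) <= t * average f x + (1 - t) * average f y.
Proof.
move=> t01; rewrite -[average f x]/(mean (f^~ x)) -[average f y]/(mean (f^~ y)).
by rewrite -!meanZ -meanD; apply: mean_le => i; exact: convex_function_le.
Qed.

Lemma fin_num_xs : Psi xs \is a fin_num.
Proof.
have [ninfty [z Pz]] := Psi_proper; rewrite fin_numE ninfty /=.
apply/eqP => Pxs; have := xs_min z; rewrite /composite Pxs /= leye_eq.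
have : Psi z \is a fin_num by rewrite fin_numE ninfty.
by move=> /fineK <-; rewrite -EFinD.
Qed.

Lemma compositeE x : Psi x \is a fin_num ->
  composite f Psi x = (average f x + fine (Psi x))%:E.
Proof. by move=> /fineK Px; rewrite EFinD Px. Qed.

Lemma composite_subE x : Psi x \is a fin_num ->
  (composite f Psi x - composite f Psi xs)%E = (gap x)%:E.
Proof. by move=> Px; rewrite !compositeE // ?fin_num_xs // -EFinB. Qed.

Lemma gap_ge0 x : Psi x \is a fin_num -> 0 <= gap x.
Proof.
move=> Px; have := xs_min x; rewrite !compositeE ?fin_num_xs // lee_fin.
by rewrite subr_ge0.
Qed.

Lemma gap_convex x y (t : R) : 0 <= t <= 1 ->
  Psi x \is a fin_num -> Psi y \is a fin_num ->
  Psi (t *: x + (1 - t) *: y) \is a fin_num /\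
  gap (t *: x + (1 - t) *: y) <= t * gap x + (1 - t) * gap y.
Proof.
move=> t01 /fineK Px /fineK Py; set z := _ + _.
have := Psi_convex x y t01; rewrite -/z -Px -Py -!EFinM -EFinD => Pz_le.
have Pz : Psi z \is a fin_num.
  rewrite fin_numE Psi_proper.1 /=; apply/eqP => Pz.
  by move: Pz_le; rewrite Pz leye_eq.
split => //; move: Pz_le; rewrite -(fineK Pz) lee_fin /gap.
by have := average_convex x y t01; rewrite -/z; lra.
Qed.

(** Minimality of [xs] bounds [Psi z] below by [F xs - average f z]; the quadratic upper bound of
    the average at [x] then gives curvature L, in the form that [prox_step_le] asks for. *)
Lemma Psi_minorant x z :
  ((average f xs + fine (Psi xs) - average f x + dot (- gmean x) (z - x)
    - L / 2 * dot (z - x) (z - x))%:E <= Psi z)%E.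
Proof.
have := xs_min z; rewrite compositeE ?fin_num_xs // /composite.
case: (Psi z) (Psi_proper.1 z) => [a| |] //= _; last by move=> _; rewrite leey.
rewrite -EFinD !lee_fin dotNl.
by have := average_smooth_le x z; lra.
Qed.

Lemma optimality u : Psi u \is a fin_num ->
  fine (Psi xs) <= fine (Psi u) + dot (gmean xs) (u - xs).
Proof.
move=> Pu; apply: (@minimizer_first_order _ _ _ Psi_convex (average f) xs u
  (gmean xs) (L / 2)); rewrite ?fineK // ?fin_num_xs //.
exact: average_smooth_le.
Qed.

(** Averaging co-coercivity gives 2 L times the Bregman divergence of the average between [x] and
    [xs]; [optimality] bounds its linear term by the difference of [Psi]. *)
Lemma mean_grad_diff_le x : Psi x \is a fin_num ->
  mean (fun i => dot (grad (f i) x - grad (f i) xs) (grad (f i) x - grad (f i) xs))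
    <= 2 * L * gap x.
Proof.
move=> Px.
have coco := mean_le (fun i => cocoercive x xs L_gt0 (f_convex i) (f_smooth i)).
apply: (le_trans coco).
rewrite meanZ !meanB -dot_vmean.
rewrite ler_pM2l ?mulr_gt0 // -[mean (f^~ x)]/(average f x) -[mean (f^~ xs)]/(average f xs).
rewrite -/(gmean xs) /gap; have := optimality Px; lra.
Qed.

Definition svrg_dir xt x (i : 'I_n) := grad (f i) x - grad (f i) xt + gmean xt.

Lemma vmean_svrg_dir xt x : vmean (svrg_dir xt x) = gmean x.
Proof.
by rewrite -[LHS]/(vmean (fun i => grad (f i) x - grad (f i) xt + gmean xt))
  vmeanD vmeanB vmean_cst // subrK.
Qed.

(** Routing through the gradients at [xs] writes the error as a difference of two centred variables,
    one for [xt] and one for [x]. Each centred second moment is at most the uncentred one, and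
    squaring the difference costs a factor 2. *)
Lemma svrg_variance xt x : Psi xt \is a fin_num -> Psi x \is a fin_num ->
  mean (fun i => dot (gmean x - svrg_dir xt x i) (gmean x - svrg_dir xt x i))
    <= 4 * L * (gap x + gap xt).
Proof.
move=> Pxt Px.
pose a y i := grad (f i) y - grad (f i) xs.
have aE y : vmean (a y) = gmean y - gmean xs.
  exact: vmeanB.
have dirE i : gmean x - svrg_dir xt x i =
    (a xt i - vmean (a xt)) - (a x i - vmean (a x)).
  by rewrite !aE /a /svrg_dir; apply/rowP => j; rewrite !mxE; ring.
have center y : Psi y \is a fin_num ->
    mean (fun i => dot (a y i - vmean (a y)) (a y i - vmean (a y))) <= 2 * L * gap y.
  move=> Py; exact: le_trans (mean_sqr_center n_gt0 _) (mean_grad_diff_le Py).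
under eq_mean do rewrite dirE.
apply: (le_trans (mean_sqrB_le _ _)).
have le20 : 0 <= 2 :> R by [].
apply: (le_trans (lerD (ler_wpM2l le20 (center xt Pxt)) (ler_wpM2l le20 (center x Px)))).
by move: (gap x) (gap xt) => gx gxt; rewrite le_eqVlt; apply/orP; left; apply/eqP; ring.
Qed.

(** Smoothness for [p], convexity for [xs] and the three-point inequality at [xs] add up. The noise
    is split at [x], since the part <gmean x - xi, x - xs> will average to zero. *)
Lemma prox_step_descent x xi (p := prox_step Psi (1 / (7 * L)) x xi) :
  Psi p \is a fin_num /\
  gap p + 7 * L / 2 * dot (p - xs) (p - xs) <=
    7 * L / 2 * dot (x - xs) (x - xs) +
    dot (gmean x - xi) (gmean x - xi) / (12 * L) + dot (gmean x - xi) (x - xs).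
Proof.
have L_neq0 : L != 0 by rewrite gt_eqF.
have eta0 : 0 < 1 / (7 * L) by rewrite divr_gt0 // mulr_gt0.
have etaE : (2 * (1 / (7 * L)))^-1 = 7 * L / 2 by field.
have ltB : L / 2 < (2 * (1 / (7 * L)))^-1 by rewrite etaE -mulrA ltr_pMl ?divr_gt0 // ltr1n.
have [a Pp] := prox_step_le Psi_proper Psi_convex Psi_lsc xi eta0 ltB
  (Psi_minorant x) (esym (fineK fin_num_xs)).
rewrite -/p etaE => le_a; rewrite Pp; split => //.
have up := average_smooth_le x p.
have low := average_grad_le x xs.
(* The proximal term supplies - 7L/2 |p - x|^2 and smoothness costs L/2 |p - x|^2; Young's
   inequality with 6 L uses exactly the remaining 3 L. *)
have L60 : 0 < 6 * L by rewrite mulr_gt0.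
have := quad_growth (gmean x - xi) (x - p) L60.
have -> : 2 * (6 * L) = 12 * L by ring.
have -> : dot (x - p) (x - p) = dot (p - x) (p - x).
  by rewrite -(opprB p x) dotNl dotNr opprK.
have linE : dot (gmean x - xi) (x - xs) - dot (gmean x - xi) (x - p) =
    dot (gmean x) (p - x) - dot (gmean x) (xs - x) + dot xi (xs - p).
  by rewrite !dotE; ring.
rewrite /gap Pp /=; lra.
Qed.

Lemma svrg_step_mean xt x
    (p := fun i => prox_step Psi (1 / (7 * L)) x (svrg_dir xt x i)) :
  Psi xt \is a fin_num -> Psi x \is a fin_num ->
  mean (fun i => gap (p i) + 7 * L / 2 * dot (p i - xs) (p i - xs)) <=
    1 / 3 * gap x + 1 / 3 * gap xt + 7 * L / 2 * dot (x - xs) (x - xs).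
Proof.
move=> Pxt Px.
apply: (le_trans (mean_le (fun i => (prox_step_descent x (svrg_dir xt x i)).2))).
rewrite !meanD mean_cst // -dot_vmean.
(* Unbiasedness of [svrg_dir] removes the linear noise term. *)
have -> : vmean (fun i => gmean x - svrg_dir xt x i) = 0.
  by rewrite vmeanB vmean_svrg_dir vmean_cst // subrr.
rewrite dot0l addr0.
under eq_mean do rewrite mulrC.
rewrite meanZ.
have /(ler_wpM2l (_ : 0 <= (12 * L)^-1)) := svrg_variance Pxt Px.
rewrite invr_ge0 => /(_ _) /=.
have -> : (12 * L)^-1 * (4 * L * (gap x + gap xt)) = 1 / 3 * gap x + 1 / 3 * gap xt.
  by field; rewrite gt_eqF.
have L120 : 0 <= 12 * L by rewrite mulr_ge0 // ltW.
by move=> /(_ L120); lra.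
Qed.

End CompositeProblem.

(** * Runs of the algorithm *)

Section Expectation.
Variables (R : realType) (K : eqType) (n : nat).
Hypothesis n_gt0 : (0 < n)%N.
Implicit Types (ks : seq K) (a : K -> 'I_n) (H : (K -> 'I_n) -> R).

(* The expectation of H when the entries of a at the keys ks are redrawn
   uniformly and independently, the last key being averaged innermost. *)
Fixpoint expect ks H a : R :=
  if ks is k :: ks' then mean (fun i => expect ks' H [eta a with k |-> i])
  else H a.

Lemma expect_cat ks1 ks2 H a :
  expect (ks1 ++ ks2) H a = expect ks1 (expect ks2 H) a.
Proof.
by elim: ks1 a => //= k ks1 IH a; apply: eq_mean => i; rewrite IH.
Qed.

(** Comparing only at assignments that agree with [a] off [ks] lets quantities determined by earlier
    draws be treated as constants. *)
Lemma expect_le ks H1 H2 a :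
  (forall b, (forall k, k \notin ks -> b k = a k) -> H1 b <= H2 b) ->
  expect ks H1 a <= expect ks H2 a.
Proof.
elim: ks a => [|k ks IH] a leH /=; first exact: leH.
apply: mean_le => i; apply: IH => b eq_ba; apply: leH => k' /norP[/negPf k'k k'ks].
by rewrite eq_ba //= k'k.
Qed.

Lemma expectZ (c : R) ks H a : expect ks (fun b => c * H b) a = c * expect ks H a.
Proof.
by elim: ks a => //= k ks IH a; rewrite -meanZ; apply: eq_mean => i; rewrite IH.
Qed.

Lemma expect_supermartingale (key : nat -> K) (V : nat -> (K -> 'I_n) -> R) m a :
  (forall t b, (t < m)%N ->
    mean (fun i => V t.+1 [eta b with key t |-> i]) <= V t b) ->
  expect [seq key t | t <- iota 0 m] (V m) a <= V 0%N a.
Proof.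
elim: m => [//|m IH] superV.
rewrite -addn1 iotaD map_cat expect_cat /= add0n.
apply: (@le_trans _ _ (expect [seq key t | t <- iota 0 m] (V m) a)).
  by apply: expect_le => b _; rewrite addn1; exact: superV.
by apply: IH => t b lt_tm; apply: superV; rewrite ltnS ltnW.
Qed.

End Expectation.

(** * Outcomes and query counts of oracle programs *)

Section Programs.
Variables (R : realType) (n d : nat) (oracle : 'I_n -> 'rV[R]_d -> 'rV[R]_d).

Lemma result_bind (A B : Type) (p : oracle_prog R n d A)
    (k : A -> oracle_prog R n d B) :
  result oracle (bind p k) = result oracle (k (result oracle p)).
Proof. by elim: p => //= i x q IH; exact: IH. Qed.

Lemma queries_bind (A B : Type) (p : oracle_prog R n d A)
    (k : A -> oracle_prog R n d B) :
  queries oracle (bind p k) =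
    (queries oracle p + queries oracle (k (result oracle p)))%N.
Proof. by elim: p => //= i x q IH; rewrite IH. Qed.

Lemma result_sum_grads s x :
  result oracle (sum_grads s x) = \sum_(i <- s) oracle i x.
Proof.
by elim: s => [|i s IH] /=; rewrite ?big_nil // result_bind /= IH big_cons.
Qed.

Lemma queries_sum_grads s x : queries oracle (sum_grads s x) = size s.
Proof. by elim: s => //= i s IH; rewrite queries_bind /= IH addn0. Qed.

Lemma result_full_grad x :
  result oracle (full_grad n x) = vmean (fun i => oracle i x).
Proof. by rewrite result_bind /= result_sum_grads big_enum. Qed.

Lemma queries_full_grad x : queries oracle (full_grad n x) = n.
Proof. by rewrite queries_bind queries_sum_grads size_enum_ord addn0. Qed.

Variables (Psi : 'rV[R]_d -> \bar R) (eta : R).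

Lemma result_inner_loopS idx xt mu x0 t :
  let st := result oracle (inner_loop Psi eta idx xt mu x0 t) in
  let x' := prox_step Psi eta st.1
    (oracle (idx t) st.1 - oracle (idx t) xt + mu) in
  result oracle (inner_loop Psi eta idx xt mu x0 t.+1) = (x', st.2 + x').
Proof.
by rewrite /= result_bind; case: (result oracle (inner_loop _ _ _ _ _ _ t)).
Qed.

Lemma queries_inner_loop idx xt mu x0 t :
  queries oracle (inner_loop Psi eta idx xt mu x0 t) = (2 * t)%N.
Proof.
elim: t => // t IH /=; rewrite queries_bind IH; case: (result _ _) => x sx /=.
by rewrite mulnS addnC.
Qed.

Lemma inner_loop_ext (idx idx' : nat -> 'I_n) xt mu x0 t :
  (forall j, (j < t)%N -> idx j = idx' j) ->
  inner_loop Psi eta idx xt mu x0 t = inner_loop Psi eta idx' xt mu x0 t.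
Proof.
elim: t => //= t IH eq_idx; rewrite eq_idx // IH // => j lt_jt.
by rewrite eq_idx // ltnS ltnW.
Qed.

Lemma result_epoch idx m xt x0 :
  let st := result oracle
    (inner_loop Psi eta idx xt (vmean (fun i => oracle i xt)) x0 m) in
  result oracle (epoch Psi eta idx m xt x0) = (m%:R^-1 *: st.2, st.1).
Proof.
by rewrite result_bind result_full_grad result_bind; case: (result _ _).
Qed.

Lemma queries_epoch idx m xt x0 :
  queries oracle (epoch Psi eta idx m xt x0) = (n + 2 * m)%N.
Proof.
rewrite queries_bind queries_full_grad queries_bind queries_inner_loop.
by case: (result _ _) => x sx; rewrite addn0.
Qed.

Variables (xphi : 'rV[R]_d) (m0 : nat).

(** Causality: later indices do not affect the state. This freezes the state after epoch S while
    epoch S + 1 is averaged, and shows that the output depends only on the listed draws. *)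
Lemma epochs_ext idx idx' S :
  (forall s t, (1 <= s <= S)%N -> (t < 2 ^ s * m0)%N -> idx s t = idx' s t) ->
  result oracle (epochs Psi xphi m0 eta idx S) =
  result oracle (epochs Psi xphi m0 eta idx' S).
Proof.
elim: S => //= S IH eq_idx; rewrite !result_bind IH; last first.
  by move=> s t /andP[s1 sS] lt_t; rewrite eq_idx // s1 ltnW.
case: (result oracle (epochs _ _ _ _ _ S)) => xt x0; rewrite !result_epoch.
by rewrite (@inner_loop_ext (idx S.+1) (idx' S.+1)) // => j lt_j; rewrite eq_idx ?ltnSn.
Qed.

Lemma result_epochsS idx S :
  let st := result oracle (epochs Psi xphi m0 eta idx S) in
  result oracle (epochs Psi xphi m0 eta idx S.+1) =
  result oracle (epoch Psi eta (idx S.+1) (2 ^ S.+1 * m0) st.1 st.2).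
Proof. by rewrite /= result_bind; case: (result oracle (epochs _ _ _ _ _ S)). Qed.

(** Inner steps cost 2 (2 + 4 + ... + 2^S) m0 = 4 (2^S - 1) m0 queries; moving 4 m0 to the left
    avoids subtraction in [nat]. *)
Lemma queries_epochs idx S :
  (queries oracle (epochs Psi xphi m0 eta idx S) + 4 * m0 =
    S * n + 4 * (2 ^ S * m0))%N.
Proof.
elim: S => [|S IH] /=; first by rewrite mul1n.
rewrite queries_bind; case: (result _ _) => xt x0.
by rewrite queries_epoch addnAC IH mulSn expnS -!mulnA; lia.
Qed.

Lemma result_svrgpp idx S :
  result oracle (svrgpp Psi xphi m0 S eta idx) =
  (result oracle (epochs Psi xphi m0 eta idx S)).1.
Proof. by rewrite result_bind; case: (result oracle (epochs _ _ _ _ _ S)). Qed.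

Lemma queries_svrgpp idx S :
  queries oracle (svrgpp Psi xphi m0 S eta idx) =
  queries oracle (epochs Psi xphi m0 eta idx S).
Proof. by rewrite queries_bind; case: (result _ _) => xt x0; rewrite addn0. Qed.

End Programs.

(** Listed in order of drawing, so that [expect] averages the latest draw innermost. *)
Fixpoint draws (m0 S : nat) : seq (nat * nat) :=
  if S is S'.+1 then draws m0 S' ++ [seq (S, t) | t <- iota 0 (2 ^ S * m0)]
  else [::].

(** * Potentials within an epoch and across epochs *)

Section Potential.
Variables (R : realType) (n d : nat) (f : 'I_n -> 'rV[R]_d -> R).
Variables (Psi : 'rV[R]_d -> \bar R) (L : R) (xs : 'rV[R]_d).
Hypotheses (n_gt0 : (0 < n)%N) (L_gt0 : 0 < L).
Hypotheses (f_convex : forall i, convex_function setT (f i)).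
Hypotheses (f_smooth : forall i, smooth L (f i)).
Hypotheses (Psi_proper : proper_fun Psi) (Psi_convex : ereal_convex Psi).
Hypotheses (Psi_lsc : lower_semicontinuous Psi).
Hypothesis xs_min : minimizers (composite f Psi) xs.
Implicit Types (x y sx xt : 'rV[R]_d) (a : nat * nat -> 'I_n).

Let oracle i := grad (f i).
Let gap := gap f Psi xs.
Let eta := 1 / (7 * L).
Let prox_fin x xi := (prox_step_descent n_gt0 L_gt0 f_convex f_smooth Psi_proper
  Psi_convex Psi_lsc xs_min x xi).1.

(* For t = 0 the running average is the junk value 0, which need not lie in the
   domain of Psi; it then carries weight 0. *)
Lemma gap_running_average t sx x :
  (t = 0%N -> sx = 0) -> ((0 < t)%N -> Psi (t%:R^-1 *: sx) \is a fin_num) ->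
  Psi x \is a fin_num ->
  Psi (t.+1%:R^-1 *: (sx + x)) \is a fin_num /\
  t.+1%:R * gap (t.+1%:R^-1 *: (sx + x)) <= t%:R * gap (t%:R^-1 *: sx) + gap x.
Proof.
case: t => [/(_ erefl) -> _ Px|t _ /(_ isT) Psx Px].
  by rewrite invr1 add0r scale1r mul0r mul1r add0r.
set T : R := t.+1%:R; have T0 : 0 < T by rewrite ltr0n.
have -> : t.+2%:R = T + 1 :> R by rewrite -natr1.
have T1 : 0 < T + 1 by lra.
pose c := T / (T + 1).
have c01 : 0 <= c <= 1.
  apply/andP; split; first by rewrite divr_ge0 // ltW.
  by rewrite ler_pdivrMr // mul1r lerDl.
have avgE : (T + 1)^-1 *: (sx + x) = c *: (T^-1 *: sx) + (1 - c) *: x.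
  rewrite scalerDr scalerA; congr (_ *: _ + _ *: _); rewrite /c; field;
  by rewrite !gt_eqF.
have [Pavg gap_le] := gap_convex xs f_convex Psi_proper Psi_convex c01 Psx Px.
rewrite avgE; split => //.
have := ler_wpM2l (ltW T1) gap_le; rewrite -/gap.
have -> // : (T + 1) * (c * gap (T^-1 *: sx) + (1 - c) * gap x) =
  T * gap (T^-1 *: sx) + gap x.
by rewrite /c; field; rewrite gt_eqF.
Qed.

Section Inner.
Variables (s m : nat) (xt x0 : 'rV[R]_d).
Hypotheses (Pxt : Psi xt \is a fin_num) (Px0 : Psi x0 \is a fin_num).

Definition inner_state a t :=
  result oracle (inner_loop Psi eta (fun t => a (s, t)) xt (gmean f xt) x0 t).

Lemma inner_stateS a t (st := inner_state a t)
    (x' := prox_step Psi eta st.1 (svrg_dir f xt st.1 (a (s, t)))) :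
  inner_state a t.+1 = (x', st.2 + x').
Proof. exact: result_inner_loopS. Qed.

Lemma inner_state_fin a t :
  [/\ Psi (inner_state a t).1 \is a fin_num,
      t = 0%N -> (inner_state a t).2 = 0 &
      (0 < t)%N -> Psi (t%:R^-1 *: (inner_state a t).2) \is a fin_num].
Proof.
elim: t => [|t [Px sx0 Psx]]; first by split.
rewrite inner_stateS; split => //; first exact: prox_fin.
move=> _; apply: (gap_running_average sx0 Psx _).1; exact: prox_fin.
Qed.

Lemma inner_state_upd a t i : inner_state [eta a with (s, t) |-> i] t = inner_state a t.
Proof.
congr result; apply: inner_loop_ext => j lt_jt /=.
by rewrite xpair_eqE eqxx /= ltn_eqF.
Qed.

(* The weights make svrg_step_mean cancel exactly: the new point enters with
   2/3 + 1/3, and each step uses up one of the m shares of gap xt / 3. *)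
Definition inner_potential t a : R := let st := inner_state a t in
  2 / 3 * (t%:R * gap (t%:R^-1 *: st.2)) + 1 / 3 * gap st.1 +
  7 * L / 2 * dot (st.1 - xs) (st.1 - xs) + (m%:R - t%:R) / 3 * gap xt.

Lemma inner_potential_super t a :
  mean (fun i => inner_potential t.+1 [eta a with (s, t) |-> i]) <=
    inner_potential t a.
Proof.
have [Px sx0 Psx] := inner_state_fin a t.
set st := inner_state a t in Px sx0 Psx.
pose p i := prox_step Psi eta st.1 (svrg_dir f xt st.1 i).
(* [c] collects the terms that do not depend on the drawn index. Jensen's inequality for the running
   average adds 2/3 of [gap (p i)] to the 1/3 already present. *)
pose c : R := 2 / 3 * (t%:R * gap (t%:R^-1 *: st.2)) + (m%:R - t.+1%:R) / 3 * gap xt.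
have step_le i : inner_potential t.+1 [eta a with (s, t) |-> i] <=
    gap (p i) + 7 * L / 2 * dot (p i - xs) (p i - xs) + c.
  rewrite /inner_potential inner_stateS inner_state_upd -/st /= eqxx -/(p i).
  have [_] := gap_running_average sx0 Psx (prox_fin st.1 (svrg_dir f xt st.1 i)).
  rewrite -/(p i) /c; lra.
apply: (le_trans (mean_le step_le)).
rewrite meanD mean_cst //.
have := svrg_step_mean n_gt0 L_gt0 f_convex f_smooth Psi_proper Psi_convex
  Psi_lsc xs_min Pxt Px.
rewrite -/gap /inner_potential -/st /c -(natr1 t).
move: (mean _) => M; lra.
Qed.

Lemma inner_potential_expect a :
  expect [seq (s, t) | t <- iota 0 m] (inner_potential m) a <=
    inner_potential 0 a.
Proof.
by apply: expect_supermartingale => t b _; exact: inner_potential_super.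
Qed.

End Inner.

Variables (xphi : 'rV[R]_d) (m0 : nat).
Hypotheses (Pxphi : Psi xphi \is a fin_num) (m0_gt0 : (0 < m0)%N).

Definition epoch_state a S :=
  result oracle (epochs Psi xphi m0 eta (fun s t => a (s, t)) S).

Lemma epoch_stateS a S (st := epoch_state a S) (m := (2 ^ S.+1 * m0)%N)
    (st' := inner_state S.+1 st.1 st.2 a m) :
  epoch_state a S.+1 = (m%:R^-1 *: st'.2, st'.1).
Proof. by rewrite /epoch_state result_epochsS result_epoch. Qed.

Let epoch_length_gt0 S : (0 < 2 ^ S * m0)%N.
Proof. by rewrite muln_gt0 expn_gt0. Qed.

Lemma epoch_state_fin a S :
  Psi (epoch_state a S).1 \is a fin_num /\
  Psi (epoch_state a S).2 \is a fin_num.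
Proof.
elim: S => // S [Pxt Px0]; rewrite epoch_stateS.
have [Px _ Psx] := inner_state_fin S.+1 (epoch_state a S).1 Px0 a
  (2 ^ S.+1 * m0).
by split => //; apply: Psx.
Qed.

Definition epoch_potential S a : R := let st := epoch_state a S in
  2 ^+ S * gap st.1 + (2 * m0%:R)^-1 * gap st.2 +
  21 * L / (4 * m0%:R) * dot (st.2 - xs) (st.2 - xs).

Lemma epoch_potential_super S a :
  expect [seq (S.+1, t) | t <- iota 0 (2 ^ S.+1 * m0)] (epoch_potential S.+1) a
    <= epoch_potential S a.
Proof.
have [Pxt Px0] := epoch_state_fin a S.
set m := (2 ^ S.+1 * m0)%N; set st := epoch_state a S in Pxt Px0.
have m0_neq0 : m0%:R != 0 :> R by rewrite pnatr_eq0 -lt0n.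
have m_neq0 : m%:R != 0 :> R by rewrite pnatr_eq0 -lt0n epoch_length_gt0.
have mE : m%:R = 2 * 2 ^+ S * m0%:R :> R by rewrite natrM natrX exprS.
(* This factor turns the weight m / 3 of the old snapshot into 2^S and, at the end of the epoch, the
   weight 2 m / 3 of the new one into 2^(S+1); here the doubling of epoch lengths enters. *)
pose c : R := 3 / (2 * m0%:R).
have c0 : 0 <= c by rewrite divr_ge0.
have -> : epoch_potential S a = c * inner_potential S.+1 m st.1 st.2 0 a.
  rewrite /epoch_potential /inner_potential -/st /= mE /c.
  by field.
apply: (@le_trans _ _ (expect [seq (S.+1, t) | t <- iota 0 m]
    (fun b => c * inner_potential S.+1 m st.1 st.2 m b) a)); last first.
  by rewrite expectZ ler_wpM2l // inner_potential_expect.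
apply: expect_le => b eq_ba.
(* The draws of epoch S + 1 do not change where that epoch starts. *)
have st_eq : epoch_state b S = st.
  apply: epochs_ext => s t /andP[_ leS] _; apply: eq_ba.
  by apply/mapP => -[t' _ [eqS _]]; rewrite eqS ltnn in leS.
rewrite /epoch_potential epoch_stateS st_eq -/m /inner_potential /=.
rewrite subrr mul0r mul0r addr0.
rewrite le_eqVlt; apply/orP; left; apply/eqP.
have -> : 2 ^+ S.+1 = m%:R / m0%:R :> R by rewrite mE exprS mulfK.
by rewrite /c; field.
Qed.

Lemma epoch_potential_expect S a :
  expect (draws m0 S) (epoch_potential S) a <= epoch_potential 0 a.
Proof.
elim: S a => [//|S IH] a /=; rewrite expect_cat.
apply: le_trans (IH a); apply: expect_le => b _.
exact: epoch_potential_super.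
Qed.

Lemma svrgpp_expect S a :
  expect (draws m0 S) (fun b => gap (epoch_state b S).1) a <=
    (2 ^+ S)^-1 * ((1 + (2 * m0%:R)^-1) * gap xphi +
      21 * L / (4 * m0%:R) * dot (xphi - xs) (xphi - xs)).
Proof.
have S0 : 0 < 2 ^+ S :> R by rewrite exprn_gt0.
rewrite ler_pdivlMl // -expectZ.
have := epoch_potential_expect S a.
rewrite {2}/epoch_potential /= expr0 -mulrDl => pot_le.
apply: le_trans pot_le.
apply: expect_le => b _; rewrite /epoch_potential -addrA lerDl.
have [_ Px0] := epoch_state_fin b S.
apply: addr_ge0; apply: mulr_ge0.
- by rewrite invr_ge0 mulr_ge0.
- exact: gap_ge0 Px0.
- by rewrite divr_ge0 // mulr_ge0 // ltW.
- exact: dot_ge0.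
Qed.

End Potential.

(** * Independent uniform draws *)

Section UniformDraws.
Variables (R : realType) (disp : measure_display) (T : measurableType disp).
Variables (P : probability T R) (K : choiceType) (D : set K) (n : nat).
Variable X : K -> T -> 'I_n.
Hypothesis X_iid : iid_uniform P D X.
Implicit Types (J : {fset K}) (a b : K -> 'I_n) (ks : seq K).

Definition draws_eq J a : set T := \bigcap_(k in [set` J]) (X k @^-1` [set a k]).

Lemma measurable_draws_eq J a : [set` J] `<=` D -> measurable (draws_eq J a).
Proof.
have [mX _ _] := X_iid.
by move=> JD; apply: fin_bigcap_measurable => // k /JD; exact: mX.
Qed.

Lemma probability_draws_eq J a : [set` J] `<=` D ->
  P (draws_eq J a) = (n%:R^-1 ^+ #|` J|)%:E.
Proof.
have [_ unif indep] := X_iid; move=> JD; rewrite /draws_eq indep //.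
rewrite big_seq (eq_bigr (fun=> (n%:R^-1)%:E)) => [|k kJ]; last first.
  by rewrite unif //; exact: JD.
rewrite -big_seq big_const_seq count_predT.
by elim: (size _) => //= m ->; rewrite exprS EFinM.
Qed.

Lemma draws_eq_fsetU1 J a k i : k \notin J ->
  draws_eq (k |` J)%fset [eta a with k |-> i] =
    draws_eq J a `&` (X k @^-1` [set i]).
Proof.
move=> kJ; apply/seteqP; split => w /=.
  move=> Aw; split; last by have := Aw k (fset1U1 _ _); rewrite /= eqxx.
  move=> k' /= k'J; have := Aw k' (fset1Ur _ k'J) => /=.
  by case: eqP => // eq_k; rewrite -eq_k k'J in kJ.
move=> [Aw Xk] k' /= /fset1UP[->|k'J] /=; first by rewrite eqxx.
by case: eqP => [->//|_]; exact: Aw.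
Qed.

Lemma draws_eq_split J a k : k \notin J ->
  draws_eq J a =
    \big[setU/set0]_(i <- enum 'I_n) draws_eq (k |` J)%fset [eta a with k |-> i].
Proof.
move=> kJ; rewrite -bigcup_seq; apply/seteqP; split => w.
  by move=> Aw; exists (X k w); rewrite /= ?mem_enum // draws_eq_fsetU1.
by move=> [i _]; rewrite draws_eq_fsetU1 // => -[].
Qed.

(* Induction on the keys still to be drawn, splitting the event that fixes the
   keys of J according to the value of the next draw. *)
Lemma integral_draws_eq ks J a (H : (K -> 'I_n) -> R) :
  (forall b, 0 <= H b) ->
  (forall b b', (forall k, k \in J \/ k \in ks -> b k = b' k) -> H b = H b') ->
  uniq ks -> (forall k, k \in ks -> k \notin J) ->
  [set` J] `<=` D -> (forall k, k \in ks -> D k) ->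
  measurable_fun (draws_eq J a) (EFin \o (fun w => H (X^~ w))) /\
  (\int[P]_(w in draws_eq J a) (H (X^~ w))%:E =
     (n%:R^-1 ^+ #|` J| * expect ks H a)%:E)%E.
Proof.
move=> H0; elim: ks J a => [|k ks IH] J a Hext /=.
  move=> _ _ JD _; have mA := measurable_draws_eq a JD.
  (* No draw is left, so [H] is constant on the event. *)
  have HA w : draws_eq J a w -> (H (X^~ w))%:E = (H a)%:E.
    by move=> Aw; congr _%:E; apply: Hext => k [kJ|//]; exact: Aw.
  split.
    by apply: (eq_measurable_fun (cst (H a)%:E)) => [w /set_mem/HA|].
  rewrite (eq_integral (cst (H a)%:E)) => [|w /set_mem/HA//].
  transitivity ((H a)%:E * (n%:R^-1 ^+ #|` J|)%:E)%E; last by rewrite -EFinM mulrC.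
  by rewrite integral_cst //; congr (_ * _)%E; exact: probability_draws_eq.
move=> /andP[k_ks uks] ksJ JD ksD.
have kJ : k \notin J by rewrite ksJ ?mem_head.
have kJD : [set` (k |` J)%fset] `<=` D.
  by move=> k' /= /fset1UP[->|/JD//]; apply: ksD; rewrite mem_head.
have IHi i := IH (k |` J)%fset [eta a with k |-> i].
have {}IHi i : measurable_fun (draws_eq (k |` J)%fset [eta a with k |-> i])
      (EFin \o (fun w => H (X^~ w))) /\
    (\int[P]_(w in draws_eq (k |` J)%fset [eta a with k |-> i]) (H (X^~ w))%:E =
     (n%:R^-1 ^+ (#|` J|).+1 * expect ks H [eta a with k |-> i])%:E)%E.
  have := IHi i; rewrite cardfsU1 kJ add1n; apply => //.
  - move=> b b' eq_b; apply: Hext => k' k'in; apply: eq_b; move: k'in.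
    rewrite in_fset1U inE => -[k'J|/orP[k'k|k'ks]]; first by left; rewrite k'J orbT.
      by left; rewrite k'k.
    by right.
  - move=> k' k'ks; rewrite in_fset1U negb_or ksJ ?inE ?k'ks ?orbT // andbT.
    by apply: contra k_ks => /eqP <-.
  - by move=> k' k'ks; apply: ksD; rewrite inE k'ks orbT.
have mB i : measurable (draws_eq (k |` J)%fset [eta a with k |-> i]).
  exact: measurable_draws_eq.
(* Measurability is inherited from the finitely many pieces and is required for additivity of the
   integral over them. *)
have mf : measurable_fun (draws_eq J a) (EFin \o (fun w => H (X^~ w))).
  rewrite (draws_eq_split a kJ) => _ Y mY.
  rewrite -bigcup_seq setI_bigcupl; apply: fin_bigcup_measurable => // i _.
  by apply: (IHi i).1.
split => //.
rewrite (draws_eq_split a kJ) ge0_integral_bigsetU ?enum_uniq //.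
- rewrite (eq_bigr _ (fun i _ => (IHi i).2)) sumEFin -mulr_sumr big_enum.
  by rewrite exprS /mean; congr _%:E; rewrite [in RHS]mulrCA mulrA.
- move=> i j _ _ [w []]; rewrite !draws_eq_fsetU1 // => -[_ /= <-] [_ /= ->].
  by [].
- by rewrite -(draws_eq_split a kJ).
- by move=> w _; rewrite lee_fin.
Qed.

(** The case of no fixed keys, whose event is the whole space. *)
Lemma integral_expect ks a (H : (K -> 'I_n) -> R) :
  (forall b, 0 <= H b) ->
  (forall b b', {in ks, b =1 b'} -> H b = H b') ->
  uniq ks -> (forall k, k \in ks -> D k) ->
  (\int[P]_w (H (X^~ w))%:E = (expect ks H a)%:E)%E.
Proof.
move=> H0 Hext uks ksD.
have [||||//|_] := @integral_draws_eq ks fset0 a H H0.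
- by move=> b b' eq_b; apply: Hext => k kks; apply: eq_b; right.
- by [].
- by [].
- by move=> k.
have -> : draws_eq fset0 a = setT by apply/seteqP; split.
by rewrite cardfs0 expr0 mul1r.
Qed.

End UniformDraws.

(** * The drawn pairs and the final bounds *)

Lemma mem_draws m0 S k :
  (k \in draws m0 S) = (1 <= k.1 <= S)%N && (k.2 < 2 ^ k.1 * m0)%N.
Proof.
case: k => s t; elim: S => [|S IH] /=; first by case: s.
rewrite mem_cat IH /=; apply/idP/idP.
  move=> /orP[/andP[/andP[-> /leqW ->]] //|/mapP[t' + [-> ->]]].
  by rewrite mem_iota add0n leqnn.
move=> /andP[/andP[s1]]; rewrite leq_eqVlt => /predU1P[-> lt_t|sS lt_t].
  by apply/orP; right; apply/mapP; exists t; rewrite // mem_iota.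
by rewrite s1 -ltnS sS lt_t.
Qed.

Lemma uniq_draws m0 S : uniq (draws m0 S).
Proof.
elim: S => //= S IH; rewrite cat_uniq IH map_inj_uniq ?iota_uniq ?andbT /=; last first.
  by move=> t t' [].
by apply/hasPn => _ /mapP[t _ ->]; rewrite mem_draws /= ltnn.
Qed.

Theorem theorem4p1 (R : realType) :
  exists C : R, 0 < C /\
  forall (n d : nat) (f : 'I_n -> 'rV[R]_d -> R) (Psi : 'rV[R]_d -> \bar R)
    (L : R) (xstar xphi : 'rV[R]_d) (m0 S : nat),
    (1 <= n)%N -> (1 <= d)%N -> 0 < L ->
    (forall i, convex_function setT (f i)) ->
    (forall i, smooth L (f i)) ->
    proper_fun Psi -> ereal_convex Psi -> lower_semicontinuous Psi ->
    minimizers (composite f Psi) xstar ->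
    (0 < m0)%N -> (0 < S)%N ->
    let F := composite f Psi in
    let oracle := fun i => grad (f i) in
    let algorithm := svrgpp Psi xphi m0 S (1 / (7 * L)) in
    (forall (disp : measure_display) (T : measurableType disp)
        (P : probability T R) (I : nat * nat -> T -> 'I_n),
      iid_uniform P (svrgpp_draws m0 S) I ->
      (\int[P]_w (F (result oracle (algorithm (fun s t => I (s, t) w)))
                  - F xstar)
       <= C%:E * ((F xphi - F xstar) * ((2 ^+ S)^-1)%:E
                  + (L * enorm (xphi - xstar) ^+ 2 / (2 ^+ S * m0%:R))%:E))%E)
    /\
    (forall idx : nat -> nat -> 'I_n,
      (queries oracle (algorithm idx))%:R
      <= C * (S%:R * n%:R + 2 ^+ S * m0%:R)).
Proof.
(* 6 dominates the three constants that arise: 4 in the query count, [1 + (2 * m0)^-1 <= 2] for the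
   initial gap and 21 / 4 for the initial distance. *)
exists 6; split=> // n d f Psi L xs xphi m0 S n_gt0 _ L_gt0 f_convex f_smooth
  Psi_proper Psi_convex Psi_lsc xs_min m0_gt0 _ F oracle algorithm.
have S0 : 0 < 2 ^+ S :> R by rewrite exprn_gt0.
have m0R : 1 <= m0%:R :> R by rewrite ler1n.
split=> [disp T P I I_iid|idx]; last first.
  rewrite queries_svrgpp -!natrM -natrX -natrM -natrD -natrM ler_nat.
  have := queries_epochs oracle Psi (1 / (7 * L)) xphi m0 idx S.
  lia.
(* When [Psi xphi] is infinite, so is the right-hand side. *)
have [Pxphi|] := boolP (Psi xphi \is a fin_num); last first.
  rewrite fin_numE Psi_proper.1 /= negbK => /eqP Pxphi.
  rewrite /F (compositeE f (fin_num_xs Psi_proper xs_min)).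
  rewrite {2}/composite Pxphi /=.
  rewrite gt0_mulye ?lte_fin ?invr_gt0 // /= gt0_muley ?lte_fin //.
  by rewrite leey.
pose G b := gap f Psi xs (epoch_state f Psi L xphi m0 b S).1.
have P_fin b := (epoch_state_fin n_gt0 L_gt0 f_convex f_smooth Psi_proper
  Psi_convex Psi_lsc xs_min Pxphi m0_gt0 b S).1.
rewrite (eq_integral (fun w => (G (I^~ w))%:E)) => [|w _]; last first.
  rewrite result_svrgpp.
  by rewrite /G -(composite_subE Psi_proper xs_min (P_fin (I^~ w))).
(* The starting assignment is arbitrary: every entry that [G] reads is redrawn. *)
rewrite (integral_expect I_iid (ks := draws m0 S) (fun=> Ordinal n_gt0)).
- rewrite /F (composite_subE Psi_proper xs_min Pxphi) -(EFinM (gap f Psi xs xphi)).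
  rewrite -EFinD -EFinM lee_fin.
  have := svrgpp_expect n_gt0 L_gt0 f_convex f_smooth Psi_proper Psi_convex
    Psi_lsc xs_min Pxphi m0_gt0 S (fun=> Ordinal n_gt0).
  move=> /le_trans; apply; rewrite sqr_enorm.
  have gap0 := gap_ge0 Psi_proper xs_min Pxphi.
  have dot0 := dot_ge0 (xphi - xs).
  set g := gap _ _ _ _ in gap0 *; set q := dot _ _ in dot0 *.
  have -> : 6 * (g / 2 ^+ S + L * q / (2 ^+ S * m0%:R)) =
      (2 ^+ S)^-1 * (6 * g + 6 * L / m0%:R * q).
    by field; rewrite !gt_eqF // (lt_le_trans ltr01).
  rewrite ler_pM2l ?invr_gt0 //; apply: lerD.
    have inv_le1 : (2 * m0%:R)^-1 <= 1 :> R by rewrite invf_le1; lra.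
    by rewrite ler_wpM2r //; lra.
  rewrite ler_wpM2r // ler_pdivrMr; last by nra.
  rewrite (_ : 6 * L / _ * _ = 24 * L); first by lra.
  by field; rewrite gt_eqF // (lt_le_trans ltr01).
- by move=> b; exact: gap_ge0 (P_fin b).
- move=> b b' eq_b; congr (gap _ _ _ _.1); apply: epochs_ext => s t sS lt_t.
  by apply: eq_b; rewrite mem_draws sS lt_t.
- exact: uniq_draws.
- by move=> k; rewrite mem_draws.
Qed.
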